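(* Let $T$ be a nonspecial, well-pruned $\omega_1$-tree. Then $\diamondsuit_T^{-}$ and $\diamondsuit_T$ are equivalent.
   Context: A tree is a partial order $(T,<_T)$ in which the set of predecessors of each node is well-ordered; every tree is assumed to have a root, denoted $\emptyset$. For $t\in T$, $t{\downarrow}=\{s\in T\mid s<_T t\}$, $\mathrm{ht}(t)$ is the order type of $t{\downarrow}$, and $T_\alpha$ is the set of nodes of height $\alpha$. The height of $T$ is the least $\alpha$ with $T_\alpha=\emptyset$. An $\omega_1$-tree is a tree of height $\omega_1$ all of whose levels $T_\alpha$ are countable. A tree $T$ of height $\kappa$ is well-pruned if for all $\alpha<\beta<\kappa$ and $s\in T_\alpha$ there is $t\in T_\beta$ with $s<_T t$. An antichain is a set of pairwise incomparable nodes. A set $U\subseteq T$ is special if it is a union of at most countably many antichains; otherwise it is nonspecial. For $X\subseteq T$, a map $f:X\to T$ is regressive if $f(t)<_T t$ for all $t\in X\setminus\{\emptyset\}$. For $T$ of height $\omega_1$, $NS^T$ is the ideal of all $B\subseteq T$ for which there is a regressive $f:B\to T$ such that $f^{-1}(\{t\})$ is special for every $t\in T$. For a nonspecial tree $T$ of height $\omega_1$: $\diamondsuit_T$ asserts that there is a sequence $(D_t\mid t\in T)$ with $D_t\subseteq t{\downarrow}$ for all $t\in T$ such that for every $X\subseteq T$, $\{t\in T\mid X\cap t{\downarrow}=D_t\}\notin NS^T$. $\diamondsuit_T^{-}$ asserts that there is a sequence $(\mathcal D_t\mid t\in T)$ with $\mathcal D_t\subseteq\mathcal P(t{\downarrow})$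 and $|\mathcal D_t|\le\omega$ for all $t\in T$ such that for every $X\subseteq T$, $\{t\in T\mid X\cap t{\downarrow}\in\mathcal D_t\}\notin NS^T$. *)

(* Defs.v *)
From mathcomp Require Import all_boot all_order.
From mathcomp Require Import all_classical.

Set Implicit Arguments.
Unset Strict Implicit.
Unset Printing Implicit Defensive.

Import Order.TTheory.

Local Open Scope classical_set_scope.
Local Open Scope order_scope.

(* Ordinals are represented by well-ordered types (possibly empty), so that an
   ordinal is determined only up to order isomorphism. *)
Record set_ordinal := SetOrdinal {
  ord_disp : Order.disp_t;
  ord_sort :> orderType ord_disp;
  ord_wo : wochoice.well_order (<=%O : rel ord_sort) }.

Definition has_order_type d (P : porderType d) (A : set P)
    (alpha : set_ordinal) :=
  exists2 f : alpha -> P, {mono f : x y / x <= y} & range f = A.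

Definition ord_lt (alpha beta : set_ordinal) :=
  exists b : beta, has_order_type [set x : beta | x < b] alpha.

(* kappa is the least uncountable ordinal. *)
Definition is_omega1 (kappa : set_ordinal) :=
  ~ countable [set: kappa] /\
  forall alpha, ord_lt alpha kappa -> countable [set: alpha].

(* The root is the bottom element of the bPOrderType. *)
Section Trees.
Context {d : Order.disp_t} (T : bPOrderType d).
Implicit Types (s t : T) (A B U X : set T) (alpha beta kappa : set_ordinal).

Definition predecessors t : set T := [set s | s < t].

Definition is_tree :=
  forall t, wochoice.wo_chain (<=%O : rel T) [in predecessors t].

Definition level alpha : set T := [set t | has_order_type (predecessors t) alpha].

Definition has_height alpha :=
  level alpha = set0 /\ forall beta, ord_lt beta alpha -> level beta !=set0.

Definition omega1_tree :=
  [/\ is_tree,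
      exists2 kappa, is_omega1 kappa & has_height kappa &
      forall alpha, countable (level alpha)].

Definition well_pruned :=
  forall kappa, has_height kappa ->
  forall alpha beta, ord_lt alpha beta -> ord_lt beta kappa ->
  forall s, level alpha s -> exists2 t, level beta t & s < t.

Definition antichain A := forall s t, A s -> A t -> s >=< t -> s = t.

Definition special U :=
  exists F : set (set T),
    [/\ countable F, F `<=` antichain & U = \bigcup_(A in F) A].

(* A map B -> T is given by a map on all of T, of which only the values on B
   are used. *)
Definition regressive B (f : T -> T) :=
  forall t, B t -> t != \bot -> f t < t.

Definition NS : set (set T) :=
  [set B | exists2 f : T -> T, regressive B f &
           forall t, special (B `&` f @^-1` [set t])].

Definition diamond :=
  exists2 D : T -> set T, forall t, D t `<=` predecessors t &
    forall X, ~ NS [set t | X `&` predecessors t = D t].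

Definition diamond_minus :=
  exists2 D : T -> set (set T),
    forall t, D t `<=` [set A | A `<=` predecessors t] /\ countable (D t) &
    forall X, ~ NS [set t | D t (X `&` predecessors t)].

End Trees.

(* Main.v *)
(** Kunen's argument.  A countable family [X_0, X_1, ...] of subsets of [T] is
    coded by a single [X]: the answer to "does the node at height [lambda + m]
    belong to [X_n]?" is stored at every node above it of height [lambda + k],
    for all [k >= m] that encode [(m, n)].  Below a node [t] of limit height
    the trace of [X] on the predecessors of [t] determines those of all the
    [X_n].  If [(D_t)] witnesses the weak diamond and [D_t = {D_t^n | n}],
    then for some [n] decoding the [n]-th component of [D_t^n] yields a diamond
    sequence: otherwise choose for each [n] a set [X_n] guessed only on a set in
    [NS] and code them together; since [NS] is a sigma-ideal containing all
    nodes of successor height, the code is guessed only on a set in [NS]. *)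
Require Import Defs.
From mathcomp Require Import all_boot all_order.
From mathcomp Require Import all_classical.

Local Open Scope classical_set_scope.

Section Ideal.
Set Implicit Arguments.
Unset Strict Implicit.
Import Order.TTheory.
Local Open Scope order_scope.
Local Open Scope classical_set_scope.
Context {d : Order.disp_t} (T : bPOrderType d).
Implicit Types (s t u : T) (A B U V : set T).

Lemma special_subset U V : U `<=` V -> special V -> special U.
Proof.
move=> UV [F [cF Fanti VF]]; exists [set A `&` U | A in F]; split.
- exact: card_le_trans (card_image_le _ _) cF.
- by move=> _ [A FA <-] s t [As _] [At _]; exact: (Fanti A FA).
- rewrite eqEsubset; split=> [s Us|s [_ [A _ <-] []]//].
  have := UV _ Us; rewrite VF => -[A FA As].
  by exists (A `&` U) => //; exists A.
Qed.

Lemma special_bigcup (U : nat -> set T) :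
  (forall n, special (U n)) -> special (\bigcup_n U n).
Proof.
move=> /choice[F FP]; exists (\bigcup_n F n); split.
- by apply: bigcup_countable => // n _; have [] := FP n.
- by move=> A [n _ FnA]; have [_ Fanti _] := FP n; exact: Fanti.
- rewrite bigcup_bigcup; apply: eq_bigcupr => n _.
  by have [_ _ ->] := FP n.
Qed.

Lemma antichain_special A : antichain A -> special A.
Proof.
by move=> Aanti; exists [set A]; split=> [|_ ->//|];
  [exact: countable1|rewrite bigcup_set1].
Qed.

Lemma NS_subset A B : A `<=` B -> NS B -> NS A.
Proof.
move=> AB [f freg fspec]; exists f => [t At|t]; first exact/freg/AB.
by apply: special_subset (fspec t); exact: setSI.
Qed.

(** Glue the regressive maps: each node [t] of the union picks some index [N t] with [t] in
    [B (N t)] and follows that map. A fibre of the result is covered by the fibres of the countably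
    many [f n]. *)
Lemma NS_bigcup (B : nat -> set T) :
  (forall n, NS (B n)) -> NS (\bigcup_n B n).
Proof.
move=> NSB.
have /choice[f fP] n : exists f, regressive (B n) f /\
    forall t, special (B n `&` f @^-1` [set t]).
  by have [f] := NSB n; exists f.
pose N t := xget 0%N [set n | B n t].
have NP t : (\bigcup_n B n) t -> B (N t) t.
  by move=> [n _ Bnt]; exact: (xgetI (P := [set n | B n t]) 0%N Bnt).
exists (fun t => f (N t) t) => [t /NP Bt|s].
  by have [freg _] := fP (N t); exact: freg.
apply: (special_subset (V := \bigcup_n (B n `&` f n @^-1` [set s]))).
  by move=> t [/NP Bt fts]; exists (N t).
by apply: special_bigcup => n; have [_] := fP n; exact.
Qed.

Lemma NS_setU A B : NS A -> NS B -> NS (A `|` B).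
Proof.
move=> NSA NSB; rewrite -bigcup2E; apply: NS_bigcup => -[|[|n]] //=.
(* The remaining sets of the padded sequence are empty. *)
by apply: NS_subset NSA.
Qed.

End Ideal.

Section Coding.
Set Implicit Arguments.
Unset Strict Implicit.
Import Order.TTheory.
Local Open Scope order_scope.
Local Open Scope classical_set_scope.
Context {d : Order.disp_t} (T : bPOrderType d).
Hypothesis treeT : is_tree T.
Implicit Types (s t u v : T) (A B X : set T).

Lemma tree_least t A : A `<=` predecessors t -> A !=set0 ->
  exists2 s, A s & forall u, A u -> s <= u.
Proof.
move=> At [a Aa].
have [|| s [[As lbs] _]] := @treeT t [in A].
- by move=> x; rewrite !inE => /At.
- by exists a; rewrite inE.
- exists s; first by rewrite inE in As.
  by move=> u Au; apply: lbs; rewrite inE.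
Qed.

Lemma tree_comparable t s u : s < t -> u < t -> s >=< u.
Proof.
move=> st ut.
have [|| v [->|->] vmin] := @tree_least t [set s; u].
- by move=> _ [->|->].
- by exists s; left.
- by apply/orP; left; apply: vmin; right.
- by apply/orP; right; apply: vmin; left.
Qed.

Lemma tree_ind (P : T -> Prop) :
  (forall t, (forall s, s < t -> P s) -> P t) -> forall t, P t.
Proof.
move=> IH t; apply: (IH) => s st; apply: contrapT => nPs.
have [|| u [ut nPu] umin] := @tree_least t [set u | u < t /\ ~ P u].
- by move=> u [].
- by exists s.
- apply: nPu; apply: IH => v vu; apply: contrapT => nPv.
  by have := umin v (conj (lt_trans vu ut) nPv); rewrite (lt_geF vu).
Qed.

Definition covers s t := s < t /\ forall u, s < u -> ~ u < t.

Lemma covers_uniq s s' t : covers s t -> covers s' t -> s = s'.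
Proof.
move=> [st sN] [st' sN'].
by case: (comparable_ltgtP (tree_comparable st st')) => // [/sN|/sN'].
Qed.

Definition limit t := ~ exists s, covers s t.

(* [t] has height [lambda + k] with [lambda] zero or a limit. *)
Fixpoint finite_height k t :=
  if k is k'.+1 then exists2 s, covers s t & finite_height k' s else limit t.

Fixpoint ancestor j s t :=
  if j is j'.+1 then exists2 u, covers u t & ancestor j' s u else s = t.

Lemma finite_height_exists t : exists k, finite_height k t.
Proof.
elim/tree_ind: t => t IH.
have [[s st]|lim] := pselect (exists s, covers s t); last by exists 0%N.
by have [k sk] := IH s st.1; exists k.+1; exists s.
Qed.

Lemma finite_height_uniq k l t :
  finite_height k t -> finite_height l t -> k = l.
Proof.
elim: k l t => [|k IH] [|l] t //=.
- by move=> lim [s st _]; case: lim; exists s.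
- by move=> [s st _] lim; case: lim; exists s.
- move=> [s st sk] [s' st' sl]; congr S.
  by apply: (IH _ s) => //; rewrite (covers_uniq st st').
Qed.

Lemma ancestor_uniq j s s' t : ancestor j s t -> ancestor j s' t -> s = s'.
Proof.
elim: j t => [|j IH] t /=; first by move=> -> ->.
move=> [u ut su] [u' ut' su']; apply: IH su _.
by rewrite (covers_uniq ut ut').
Qed.

Lemma finite_height_ancestor j k s t :
  finite_height k s -> ancestor j s t -> finite_height (j + k)%N t.
Proof.
move=> sk; elim: j t => [|j IH] t /=; first by move=> <-.
by move=> [u ut /IH uk]; exists u.
Qed.

(** Climb one step at a time: as [t] is a limit, a node [u < t] is not its immediate predecessor, so
    some node lies strictly between them, and the least such node is an immediate successor of
    [u]. *)
Lemma ancestor_below_limit j s t :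
  limit t -> s < t -> exists2 u, u < t & ancestor j s u.
Proof.
move=> lim st; elim: j => [|j [u ut su]]; first by exists s.
have [|| v [uv vt] vmin] := @tree_least t [set v | u < v /\ v < t].
- by move=> v [].
- apply: contrapT => N; apply: lim; exists u; split=> // v uv vt.
  by apply: N; exists v.
- exists v => //=; exists u => //; split=> // w uw wv.
  have /le_lt_trans/(_ wv) := vmin w (conj uw (lt_trans wv vt)).
  by rewrite ltxx.
Qed.

(** Taking immediate predecessors is regressive, and each fibre consists of immediate successors of
    a single node, which are pairwise incomparable. *)
Lemma NS_successors : NS [set t | ~ limit t].
Proof.
have /choice[f fP] t : exists s, ~ limit t -> covers s t.
  have [lim|/contrapT[s st]] := pselect (limit t); first by exists t.
  by exists s.
exists f => [t /fP[]//|s].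
apply: antichain_special => t u [/fP tP /= <-] [/fP [fu Nu] /= eu].
rewrite eu in fu Nu; case: tP => ft Nt.
by move=> /comparable_ltgtP[/(Nu _ ft)|/(Nt _ fu)|].
Qed.

(* A node of finite height [k] stores information on the pair [(m, n)] of the
   exponents of 2 and 3 in [k]; its ancestor of finite height [m] exists
   because [m <= k]. *)
Definition code (X : nat -> set T) : set T :=
  [set u | exists k s, [/\ finite_height k u,
     ancestor (k - logn 2 k)%N s u & X (logn 3 k) s]].

Definition decode n A t : set T :=
  [set s | s < t /\ exists k u, [/\ finite_height k u,
     ancestor (k - logn 2 k)%N s u, logn 3 k = n & A u]].

Lemma decode_code (X : nat -> set T) n t : limit t ->
  decode n (code X `&` predecessors t) t = X n `&` predecessors t.
Proof.
move=> lim; rewrite eqEsubset; split=> s.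
  (* The node [u] determines [k], hence the index and the distance down to [s], so what is stored at
     [u] concerns [s] itself. *)
  move=> [st [k [u [uk su <- [[l [s' [ul s'u Xs']]] _]]]]].
  rewrite (finite_height_uniq ul uk) in s'u Xs'.
  by split=> //; rewrite -(ancestor_uniq s'u su).
move=> [Xs st]; split=> //.
have [m sm] := finite_height_exists s.
(* The answer for [s] and [X n] is stored at finite height [k]; since [t] is a limit, such a node
   above [s] exists below [t]. *)
pose k := (2 ^ m * 3 ^ n)%N.
have k2 : logn 2 k = m.
  rewrite lognM ?expn_gt0 // !lognX (lognE 2 3) (lognE 2 2) /=.
  by rewrite muln0 addn0 muln1.
have k3 : logn 3 k = n.
  by rewrite lognM ?expn_gt0 // !lognX (lognE 3 3) (lognE 3 2) /= muln0 muln1.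
have mk : (m <= k)%N.
  apply: leq_trans (ltnW (ltn_expl m (isT : 1 < 2)%N)) _.
  by rewrite leq_pmulr ?expn_gt0.
have [u ut su] := ancestor_below_limit (k - m)%N lim st.
have uk : finite_height k u.
  by rewrite -(subnK mk); exact: finite_height_ancestor su.
by exists k, u; split; rewrite ?k2 //; split=> //; exists k, s; rewrite k2 k3.
Qed.

End Coding.

(** Values of [e] outside [A] are allowed, so an empty [A] needs no separate case. *)
Lemma countable_surj {U : choiceType} (x0 : U) (A : set U) : countable A ->
  exists e : nat -> U, forall x, A x -> exists n, e n = x.
Proof.
move=> /countable_injP[f finj].
exists (fun n => xget x0 [set x | A x /\ f x = n]) => x Ax; exists (f x).
have [Ay fy] := xgetI (P := [set y | A y /\ f y = f x]) x0 (conj Ax erefl).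
by apply: finj => //; rewrite inE.
Qed.

Theorem theorem3p9 (d : Order.disp_t) (T : bPOrderType d) :
  omega1_tree T -> well_pruned T -> ~ special [set: T] ->
  (diamond_minus T <-> diamond T).
Proof.
move=> [treeT _ _] _ _; split=> [[D DP guess]|[D DP guess]]; last first.
  exists (fun t => [set D t]) => [t|X]; last exact: guess.
  by split=> [_ ->|]; [exact: DP|exact: countable1].
have /choice[e eP] t :
    exists e : nat -> set T, forall A, D t A -> exists n, e n = A.
  exact: (countable_surj set0 (DP t).2).
apply: contrapT => Ndiamond.
have /choice[X XP] n : exists X,
    NS [set t | X `&` predecessors t = decode n (e t n) t].
  apply: contrapT => NX; apply: Ndiamond.
  exists (fun t => decode n (e t n) t) => [t s []//|X NSX].
  by apply: NX; exists X.
apply: (guess (code X)).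
have NSU := NS_setU (NS_successors T) (NS_bigcup XP).
(* If [e t n] is the trace of the code at a limit node [t], decoding it gives the trace of [X n], so
   [t] lies in the [n]-th small set. *)
apply: (NS_subset _ NSU) => t /= /eP[n en].
have [lim|] := pselect (limit t); last by left.
by right; exists n => //=; rewrite en decode_code.
Qed.
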